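(* Let $X\subset\mathbb{R}^d$ be compact and let $f\in\mathrm{PAff}(X;X)$ be a piecewise affine map that is conformal and non-expanding. Then $h_{\mathrm{top}}(f)=0$.
   Context: **Piecewise affine maps.** A piecewise affine map $(X,\mathcal Z,f)$, written $f\in\mathrm{PAff}(X;X)$, consists of a compact set $X\subset\mathbb{R}^d$, a finite collection $\mathcal Z$ of open, pairwise disjoint polytopes such that $X'=\bigcup_{Z\in\mathcal Z}Z$ is dense in $X$, and a map $f:X'\to X$ such that $f_Z:=f|_Z:Z\to X$ is affine for each $Z\in\mathcal Z$. The $f_Z$ are the affine components of $f$; the linear part of $f_Z$ is $f_Z'$. $f$ is conformal if all its affine components are conformal, i.e. each $f_Z'$ is a nonzero scalar multiple of an orthogonal matrix. $f$ is non-expanding if all its affine components are non-expanding, i.e. for each $Z\in\mathcal Z$ the eigenvalues of $f_Z'$ have absolute values not exceeding $1$. Put $U_n=\bigcap_{k=0}^{n-1}f^{-k}(X')$, the set of points where $f^n$ is defined. **Topological entropy.** Let $d(\cdot,\cdot)$ be a metric defining the standard topology on $X$, $d_n^f(x,y)=\max_{0\le k<n}d(f^kx,f^ky)$, and let $S(d_n^f,\epsilon)$ be the minimal number of $d_n^f$-balls of radius $\epsilon$ needed to cover $U_n$. Then $h_{\mathrm{top}}(f)=\lim_{\epsilon\to0}\limsup_{n\to\infty}\frac1n\log S(d_n^f,\epsilon)$ (independent of the choice of metric). *)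

(* Defs.v *)
From mathcomp Require Export all_boot all_order all_algebra.
From mathcomp Require Export all_classical all_reals all_analysis.
From mathcomp Require Export complex.
Export Order.TTheory GRing.Theory Num.Theory.
Export numFieldNormedType.Exports.

Set Implicit Arguments.
Unset Strict Implicit.
Unset Printing Implicit Defensive.

Local Open Scope classical_set_scope.
Local Open Scope ring_scope.

Section PiecewiseAffine.
Context {R : realType} {d : nat}.
Local Notation V := 'cV[R]_d.
Implicit Types (X Z : set V) (ZZ : set (set V)) (f : V -> V) (A Q : 'M[R]_d).

(* Polytopes are convex: an open polytope is a bounded intersection of finitely
   many open half-spaces [(A x)_i < b_i]. *)
Definition open_polytope Z :=
  bounded_set Z /\
  exists (m : nat) (A : 'M[R]_(m, d)) (b : 'cV[R]_m),
    Z = [set x | forall i : 'I_m, (A *m x) i 0 < b i 0].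

(* [A] is the linear part of the affine map [f] restricted to [Z]; it is unique
   as soon as [Z] is open and nonempty. *)
Definition linear_part f Z A := exists b : V, forall x, Z x -> f x = A *m x + b.

Definition affine_on f Z := exists A, linear_part f Z A.

Definition domain ZZ : set V := \bigcup_(Z in ZZ) Z.

(* The partially defined map of X' = [domain ZZ] into [X] is represented by a
   total function [f]; the values of [f] outside [domain ZZ] are never used. *)
Record PAff X ZZ f : Prop := {
  PAff_compact : compact X;
  PAff_finite : finite_set ZZ;
  PAff_polytope : forall Z, ZZ Z -> open_polytope Z;
  PAff_disjoint : forall Z1 Z2, ZZ Z1 -> ZZ Z2 -> Z1 <> Z2 -> Z1 `&` Z2 = set0;
  PAff_sub : domain ZZ `<=` X;
  PAff_dense : X `<=` closure (domain ZZ);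
  PAff_maps : forall x, domain ZZ x -> X (f x);
  PAff_affine : forall Z, ZZ Z -> affine_on f Z }.

Definition orthogonal_mx Q := Q^T *m Q = 1%:M.

Definition conformal_mx A :=
  exists (c : R) Q, [/\ c != 0, orthogonal_mx Q & A = c *: Q].

Definition complex_mx A : 'M[R[i]]_d := map_mx (real_complex R) A.

Definition non_expanding_mx A :=
  forall z : R[i], eigenvalue (complex_mx A) z -> `|z| <= 1.

Definition conformal ZZ f :=
  forall Z, ZZ Z -> exists2 A, linear_part f Z A & conformal_mx A.

Definition non_expanding ZZ f :=
  forall Z, ZZ Z -> exists2 A, linear_part f Z A & non_expanding_mx A.

End PiecewiseAffine.

Section Entropy.
Context {R : realType} {d : nat}.
Local Notation V := 'cV[R]_d.
Implicit Types (X : set V) (ZZ : set (set V)) (f : V -> V) (rho : V -> V -> R).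

(* [rho] restricted to [X] is a metric, and its balls generate the topology that
   [X] inherits from R^d. *)
Record defines_topology X rho : Prop := {
  metric_eq0 : forall x y, X x -> X y -> rho x y = 0 <-> x = y;
  metric_sym : forall x y, X x -> X y -> rho x y = rho y x;
  metric_triangle : forall x y z, X x -> X y -> X z ->
    rho x z <= rho x y + rho y z;
  metric_nbhs : forall x, X x -> forall A : set V,
    within X (nbhs x) A <->
    exists2 e, 0 < e & forall y, X y -> rho x y < e -> A y }.

(* Since all earlier iterates are required to lie in [domain ZZ], membership
   does not depend on the values of [f] outside [domain ZZ]. *)
Definition iter_domain X ZZ f (n : nat) : set V :=
  [set x | X x /\ forall k, (k < n)%N -> domain ZZ (iter k f x)].

Definition bowen_metric f rho (n : nat) (x y : V) : R :=
  \big[Num.max/0]_(k < n) rho (iter k f x) (iter k f y).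

Definition covers X ZZ f rho (n : nat) (e : R) (s : seq V) :=
  (forall x, x \in s -> iter_domain X ZZ f n x) /\
  (forall y, iter_domain X ZZ f n y ->
     exists2 x, x \in s & bowen_metric f rho n x y < e).

(* +oo if no finite family of balls covers *)
Definition covering_number X ZZ f rho (n : nat) (e : R) : \bar R :=
  ereal_inf [set (size s)%:R%:E | s in covers X ZZ f rho n e].

(* [er_map ln] sends +oo to +oo and, because [ln 0 = 0], sends 0 to 0; the
   covering number is 0 only if [iter_domain X ZZ f n] is empty. *)
Definition entropy_at X ZZ f rho (e : R) : \bar R :=
  limn_esup (fun n : nat =>
    (n%:R^-1)%:E * er_map (@ln R) (covering_number X ZZ f rho n e))%E.

Definition htop X ZZ f rho : \bar R :=
  lim (entropy_at X ZZ f rho e @[e --> 0^'+]).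

Lemma covering_number_le X ZZ f rho n e1 e2 : e1 <= e2 ->
  (covering_number X ZZ f rho n e2 <= covering_number X ZZ f rho n e1)%E.
Proof.
move=> e12; apply: ereal_inf_le_tmp => _ [s [sU cs] <-]; exists s => //.
by split=> // y /cs[x xs xy]; exists x => //; apply: lt_le_trans e12.
Qed.

Lemma covering_number_natVinfty X ZZ f rho n e :
  covering_number X ZZ f rho n e = +oo%E \/
  exists k : nat, covering_number X ZZ f rho n e = k%:R%:E.
Proof.
case: (pselect (exists k, `[<exists2 s, covers X ZZ f rho n e s & size s = k>])).
  move=> ex; right; case: (ex_minnP ex) => k /asboolP[s cs sk] kmin.
  exists k; apply/eqP; rewrite eq_le; apply/andP; split.
    by apply: ereal_inf_lbound; exists s => //; rewrite sk.
  apply/ereal_infP => _ [t ct <-]; rewrite lee_fin ler_nat.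
  by apply: kmin; apply/asboolP; exists t.
move=> nex; left; rewrite /covering_number -[RHS]ereal_inf0; congr ereal_inf.
apply/seteqP; split=> // t [s cs _]; case: nex; exists (size s).
by apply/asboolP; exists s.
Qed.

Lemma entropy_at_nonincreasing X ZZ f rho e1 e2 : e1 <= e2 ->
  (entropy_at X ZZ f rho e2 <= entropy_at X ZZ f rho e1)%E.
Proof.
move=> e12; apply/ereal_infP => _ [A FA <-].
apply: (@le_trans _ _ (ereal_sup ((fun n : nat =>
   (n%:R^-1)%:E * er_map (@ln R) (covering_number X ZZ f rho n e2))%E @` A))).
  by apply: ereal_inf_lbound; exists A.
apply/ereal_supP => _ [n An <-].
apply: le_trans (ereal_sup_ubound _); last by exists n; [exact: An|reflexivity].
apply: lee_wpmul2l; first by rewrite lee_fin invr_ge0.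
have := @covering_number_le X ZZ f rho n _ _ e12.
case: (covering_number_natVinfty X ZZ f rho n e1) => [->|[k ->]].
  by move=> _; rewrite leey.
case: (covering_number_natVinfty X ZZ f rho n e2) => [->|[l ->]]; first by rewrite leye_eq.
rewrite /= !lee_fin ler_nat; case: l => [|l lk].
  rewrite ln0// => _; case: k => [|k]; first by rewrite ln0.
  by apply: ln_ge0; rewrite ler1n.
by rewrite ler_ln ?ler_nat// posrE ltr0n// (leq_trans _ lk).
Qed.

(* the limit defining [htop] always exists *)
Lemma entropy_at_cvg X ZZ f rho :
  entropy_at X ZZ f rho e @[e --> 0^'+] --> htop X ZZ f rho.
Proof.
apply: nonincreasing_at_right_is_cvge; near=> b => x y _ _ xy.
exact: entropy_at_nonincreasing.
Unshelve. all: by end_near. Qed.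

End Entropy.

(* Main.v *)
(* A conformal non-expanding component is x |-> c Q x + b with 0 < c <= 1 and Q
   orthogonal, so points with the same itinerary never separate, and the entropy
   is at most the exponential growth rate of the number of itineraries. As f does
   not expand, a sufficiently thin set stays thin, and that growth rate is at most
   the one of the itineraries of germs at a point x (multiplicity entropy). By
   conformality the germs evolve under the orthogonal matrices Q, so the same
   argument on the unit sphere of directions bounds the germs at x by the germs at
   a flag (x, v_1), then (x, v_1, v_2), and so on. A flag longer than d does not
   exist, which ends the descent. Uniformity in the flag holds because only
   finitely many pulled-back facet normals matter for words of bounded length. *)

Require Import Defs.
From mathcomp Require Import ring lra.
From mathcomp Require spectral.

Set Implicit Arguments.
Unset Strict Implicit.
Unset Printing Implicit Defensive.

Local Open Scope classical_set_scope.
Local Open Scope ring_scope.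

(** * Counting words *)

Section WordCounting.
Context {I : finType}.
Implicit Types (n : nat) (P : seq I -> Prop) (w p : seq I).
Local Open Scope nat_scope.

(** Summing over the first letter makes every counting induction peel off one step of the
    dynamics. *)
Fixpoint word_count n P : nat :=
  if n is n'.+1 then \sum_(i : I) word_count n' (fun w => P (i :: w))
  else `[< P [::] >].

Lemma word_count_le n P P' : (forall w, size w = n -> P w -> P' w) ->
  word_count n P <= word_count n P'.
Proof.
elim: n P P' => [|n IHn] P P' PP' /=.
  by case: asboolP => // P0; rewrite asboolT//; exact: PP'.
by apply: leq_sum => i _; apply: IHn => w wn; apply: PP' => /=; rewrite wn.
Qed.

Lemma word_count_eq0 n P : (forall w, size w = n -> ~ P w) -> word_count n P = 0.
Proof.
elim: n P => [|n IHn] P nP /=; first by rewrite asboolF//; exact: nP.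
by rewrite big1// => i _; apply: IHn => w wn; apply: nP => /=; rewrite wn.
Qed.

Lemma word_count_le1 n P :
  (forall w w', size w = n -> size w' = n -> P w -> P w' -> w = w') ->
  word_count n P <= 1.
Proof.
elim: n P => [|n IHn] P P1 /=; first by case: asboolP.
have [[i [w [wn Pw]]]|nP] := pselect (exists i w, size w = n /\ P (i :: w)).
  rewrite (bigD1 i)//= big1 ?addn0.
    apply: IHn => v v' vn v'n Pv Pv'.
    by have [] : i :: v = i :: v' by apply: P1; rewrite //= ?vn ?v'n.
  move=> j ji; apply: word_count_eq0 => v vn Pv.
  have [ij _] : i :: w = j :: v by apply: P1; rewrite //= ?vn ?wn.
  by rewrite ij eqxx in ji.
by rewrite big1// => i _; apply: word_count_eq0 => w wn Pw; apply: nP; exists i, w.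
Qed.

Lemma word_count_or n P P' :
  word_count n (fun w => P w \/ P' w) <= word_count n P + word_count n P'.
Proof.
elim: n P P' => [|n IHn] P P' /=.
  by case: asboolP => // -[] P0; rewrite (asboolT P0) ?addnS.
by rewrite -big_split/=; apply: leq_sum => i _; exact: IHn.
Qed.

Lemma word_count_exists (K : finType) n (P : K -> seq I -> Prop) :
  word_count n (fun w => exists k, P k w) <= \sum_(k : K) word_count n (P k).
Proof.
elim: n P => [|n IHn] P /=.
  case: asboolP => // -[k Pk]; rewrite (bigD1 k)//= asboolT//.
rewrite exchange_big/=; apply: leq_sum => i _; exact: IHn.
Qed.

Lemma word_count_cat a b P P1 e :
  (forall p w, size p = a -> P (p ++ w) -> P1 p) ->
  (forall p, size p = a -> word_count b (fun w => P (p ++ w)) <= e) ->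
  word_count (a + b) P <= word_count a P1 * e.
Proof.
elim: a P P1 => [|a IHa] P P1 PP1 Pe /=.
  rewrite add0n; case: asboolP => [_|nP1]; first by rewrite mul1n; exact: (Pe [::]).
  by rewrite word_count_eq0// => w _ Pw; apply: nP1; exact: (PP1 [::] w).
rewrite big_distrl/=; apply: leq_sum => i _; apply: IHa => [p w pa|p pa].
  by apply: (PP1 (i :: p)) => /=; rewrite pa.
by apply: (Pe (i :: p)) => /=; rewrite pa.
Qed.

Lemma word_count_exp n P : word_count n P <= #|I| ^ n.
Proof.
elim: n P => [|n IHn] P /=; first by case: asboolP.
by rewrite expnS -sum_nat_const; apply: leq_sum => i _; exact: IHn.
Qed.

(** Turns a count into a list, from which the centres of the covering balls are built. *)
Lemma word_enum n P : exists s : seq (seq I),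
  size s = word_count n P /\ (forall w, w \in s <-> size w = n /\ P w).
Proof.
elim: n P => [|n IHn] P /=.
  case: asboolP => P0; [exists [:: [::]]|exists [::]]; split=> // w; split.
  - by rewrite inE => /eqP ->.
  - by case=> /size0nil -> _; rewrite inE.
  - by rewrite in_nil.
  - by case=> /size0nil ->.
have /choice[s sP] : forall i, exists s : seq (seq I),
  size s = word_count n (fun w => P (i :: w)) /\
  (forall w, w \in s <-> size w = n /\ P (i :: w)) by move=> i; exact: IHn.
exists (flatten [seq [seq i :: w | w <- s i] | i <- enum I]); split.
  rewrite size_flatten /shape -map_comp sumnE big_map big_enum.
  by apply: eq_bigr => i _ /=; rewrite size_map; case: (sP i).
move=> w; split=> [/flatten_mapP[i _ /mapP[v /(sP i).2[vn Pv] ->]]|].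
  by rewrite /= vn.
case: w => [[]//|i w [/= [wn] Pw]].
apply/flatten_mapP; exists i; first by rewrite mem_enum.
by apply/mapP; exists w => //; apply/(sP i).2.
Qed.

(* Submultiplicativity: [good] is preserved by the dynamics, so the bound at time [m]
   can be iterated. *)
Lemma word_count_bootstrap (St : Type) (alive : St -> seq I -> Prop)
    (good : St -> Prop) m c :
  (forall s, good s -> word_count m (alive s) <= c) ->
  (forall s p w, alive s (p ++ w) -> alive s p) ->
  (forall s p, good s -> size p = m ->
    exists2 s', good s' & forall w, alive s (p ++ w) -> alive s' w) ->
  forall k s, good s -> word_count (k * m) (alive s) <= c ^ k.
Proof.
move=> ac acat anext; elim=> [|k IHk] s gs; first by rewrite word_count_exp.
rewrite mulSn expnS; apply: (@leq_trans (word_count m (alive s) * c ^ k)).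
  apply: word_count_cat => [p w _|p pm]; first exact: acat.
  have [s' gs' ss'] := anext s p gs pm.
  by apply: leq_trans (IHk s' gs'); apply: word_count_le => w _; exact: ss'.
by rewrite leq_mul2r ac ?orbT.
Qed.

End WordCounting.

(** * Dot product and orthonormal families *)

Section Dot.
Context {R : realType} {d : nat}.
Local Notation V := 'cV[R]_d.
Implicit Types (a u v w : V) (vs : seq V).

Definition dot u v : R := \sum_i u i 0 * v i 0.

Lemma dotC u v : dot u v = dot v u.
Proof. by apply: eq_bigr => i _; rewrite mulrC. Qed.

Lemma dotDr a u v : dot a (u + v) = dot a u + dot a v.
Proof. by rewrite -big_split; apply: eq_bigr => i _; rewrite mxE mulrDr. Qed.

Lemma dotZr a (k : R) v : dot a (k *: v) = k * dot a v.
Proof. by rewrite mulr_sumr; apply: eq_bigr => i _; rewrite mxE mulrCA. Qed.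

Lemma dotNr a v : dot a (- v) = - dot a v.
Proof. by rewrite -scaleN1r dotZr mulN1r. Qed.

Lemma dotBr a u v : dot a (u - v) = dot a u - dot a v.
Proof. by rewrite dotDr dotNr. Qed.

Lemma dot0r a : dot a 0 = 0.
Proof. by rewrite -(scale0r a) dotZr mul0r. Qed.

Lemma dotZl a (k : R) v : dot (k *: v) a = k * dot v a.
Proof. by rewrite !(dotC _ a) dotZr. Qed.

Lemma dotNl a v : dot (- v) a = - dot v a.
Proof. by rewrite !(dotC _ a) dotNr. Qed.

Lemma dotBl a u v : dot (u - v) a = dot u a - dot v a.
Proof. by rewrite !(dotC _ a) dotBr. Qed.

Lemma dot_mulmx (A : 'M[R]_d) u v : dot u (A *m v) = dot (A^T *m u) v.
Proof.
rewrite /dot (eq_bigr (fun i => \sum_j u i 0 * (A i j * v j 0))); last first.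
  by move=> i _; rewrite mxE mulr_sumr.
rewrite exchange_big; apply: eq_bigr => j _; rewrite mxE mulr_suml.
by apply: eq_bigr => i _; rewrite mxE mulrCA mulrA.
Qed.

Lemma dot_orthogonal (Q : 'M[R]_d) u v : orthogonal_mx Q ->
  dot (Q *m u) (Q *m v) = dot u v.
Proof. by move=> QQ; rewrite dot_mulmx mulmxA QQ mul1mx. Qed.

Lemma dot_ge0 u : 0 <= dot u u.
Proof. by apply: sumr_ge0 => i _; rewrite -expr2 sqr_ge0. Qed.

Lemma dot_eq0 u : (dot u u == 0) = (u == 0).
Proof.
apply/eqP/eqP => [uu|->]; last exact: dot0r.
have u0 i : u i 0 * u i 0 = 0.
  move/eqP: uu; rewrite psumr_eq0; last by move=> j _; rewrite -expr2 sqr_ge0.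
  by move/allP/(_ i (mem_index_enum _))/eqP.
apply/matrixP => i j; rewrite (ord1 j) mxE.
by have /eqP := u0 i; rewrite mulf_eq0 orbb => /eqP.
Qed.

Lemma dot_gt0 u : u != 0 -> 0 < dot u u.
Proof. by move=> u0; rewrite lt_def dot_eq0 u0 dot_ge0. Qed.

(** The norm on vectors is the sup norm, while orthogonal matrices preserve [dot]; this and the next
    lemmas compare the two. *)
Lemma entry_le_norm u i : `|u i 0| <= `|u|.
Proof. by rewrite [leRHS]/Num.norm/= mx_normrE; apply: (le_bigmax _ _ (i, 0)). Qed.

Lemma norm_le_entry u (e : R) : 0 <= e -> (forall i, `|u i 0| <= e) -> `|u| <= e.
Proof.
move=> e0 ue; rewrite [leLHS]/Num.norm/= mx_normrE.
by apply: bigmax_le => // -[i j] _ /=; rewrite (ord1 j).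
Qed.

Lemma norm_lt_entry u (e : R) : 0 < e -> (forall i, `|u i 0| < e) -> `|u| < e.
Proof.
move=> e0 ue; rewrite [ltLHS]/Num.norm/= mx_normrE.
by apply: bigmax_lt => // -[i j] _ /=; rewrite (ord1 j).
Qed.

Lemma dot_le_norm u v : `|dot u v| <= d%:R * `|u| * `|v|.
Proof.
apply: le_trans (ler_norm_sum _ _ _) _.
have -> : d%:R * `|u| * `|v| = \sum_(i < d) (`|u| * `|v|).
  by rewrite sumr_const card_ord -[RHS]mulr_natl mulrA.
by apply: ler_sum => i _; rewrite normrM ler_pM// entry_le_norm.
Qed.

Lemma sqr_norm_le_dot u : `|u| ^+ 2 <= dot u u.
Proof.
have e0 := dot_ge0 u.
rewrite -(sqr_sqrtr e0) lerXn2r ?nnegrE ?sqrtr_ge0//.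
apply: norm_le_entry => [|i]; rewrite ?sqrtr_ge0//.
rewrite -sqrtr_sqr ler_wsqrtr// /dot (bigD1 i)//= expr2 lerDl.
by apply: sumr_ge0 => j _; rewrite -expr2 sqr_ge0.
Qed.

Lemma norm_lt_dot u (e : R) : 0 < e -> dot u u < e ^+ 2 -> `|u| < e.
Proof.
move=> e0 ue; rewrite -ltr_sqr ?nnegrE ?normr_ge0 ?(ltW e0)//.
exact: le_lt_trans (sqr_norm_le_dot u) ue.
Qed.

Lemma dot_lt_norm u (e : R) : 0 < e -> `|u| < e / d.+1%:R -> dot u u < e ^+ 2.
Proof.
move=> e0 ue; have d0 : (0 : R) < d.+1%:R by rewrite ltr0n.
apply: (@le_lt_trans _ _ (d.+1%:R * (`|u| * `|u|))).
  apply: le_trans (ler_norm _) _; apply: le_trans (dot_le_norm _ _) _.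
  by rewrite -mulrA ler_wpM2r ?mulr_ge0// ler_nat.
have ue' : d.+1%:R * `|u| < e by rewrite mulrC -ltr_pdivlMr.
apply: (@le_lt_trans _ _ ((d.+1%:R * `|u|) ^+ 2)).
  rewrite expr2 mulrACA -[leLHS]mul1r mulrA ler_wpM2r ?mulr_ge0//.
  by rewrite -natrM -[leLHS]mulr1n mul1r ler_nat leq_pmulr.
by rewrite ltr_sqr ?nnegrE ?mulr_ge0 ?(ltW e0).
Qed.

Definition orthonormal vs :=
  all (fun v => dot v v == 1) vs && pairwise (fun u v => dot u v == 0) vs.

Lemma orthonormal_rcons vs v : orthonormal (rcons vs v) =
  [&& orthonormal vs, dot v v == 1 & all (fun w => dot w v == 0) vs].
Proof. by rewrite /orthonormal all_rcons pairwise_rcons andbACA andbC. Qed.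

Lemma orthonormal_map (Q : 'M[R]_d) vs : orthogonal_mx Q ->
  orthonormal (map (mulmx Q) vs) = orthonormal vs.
Proof.
move=> QQ; rewrite /orthonormal all_map pairwise_map; congr (_ && _).
  by apply: eq_all => v /=; rewrite dot_orthogonal.
by apply: eq_pairwise => u v /=; rewrite dot_orthogonal.
Qed.

(** The Gram matrix of the family is the identity, so its rank, the length of the family, is at most
    that of a matrix with [d] rows. *)
Lemma size_orthonormal vs : orthonormal vs -> (size vs <= d)%N.
Proof.
case/andP=> /allP vs1 /(pairwiseP 0) vs0.
pose M : 'M[R]_(d, size vs) := \matrix_(i, j) vs`_j i 0.
have MM : M^T *m M = 1%:M.
  apply/matrixP => i j; rewrite !mxE (eq_bigr (fun k => vs`_i k 0 * vs`_j k 0)); last first.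
    by move=> k _; rewrite !mxE.
  rewrite -/(dot _ _); have [<-|ij] := eqVneq i j.
    by apply/eqP/vs1; rewrite mem_nth.
  move: ij; rewrite -val_eqE neq_ltn => /orP[ij|ij]; last rewrite dotC.
  + by apply/eqP/vs0; rewrite ?inE.
  + by apply/eqP/vs0; rewrite ?inE.
have := mxrankM_maxr M^T M; rewrite MM mxrank1 => /leq_trans; apply.
exact: rank_leq_row.
Qed.

End Dot.

(** * Localization of finitely many functionals *)

Lemma uniform_witness {R : realFieldType} (T : eqType) (s : seq T) (P : T -> R -> Prop) :
  (forall x e e', 0 < e' -> e' <= e -> P x e -> P x e') ->
  (forall x, x \in s -> exists2 e, 0 < e & P x e) ->
  exists2 e, 0 < e & forall x, x \in s -> P x e.
Proof.
move=> Pmono; elim: s => [|x s IHs] sP; first by exists 1.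
have [e e0 Pe] := sP x (mem_head _ _).
have [|e' e'0 Pe'] := IHs; first by move=> y ys; apply: sP; rewrite inE ys orbT.
exists (Num.min e e') => [|y]; first by rewrite lt_min e0.
rewrite inE => /predU1P[->|ys].
  by apply: Pmono Pe; rewrite ?lt_min ?e0 ?ge_min ?lexx.
by apply: Pmono (Pe' y ys); rewrite ?lt_min ?e0 ?ge_min ?lexx ?orbT.
Qed.

Section Localization.
Context {R : realType} {d : nat}.
Local Notation V := 'cV[R]_d.
Implicit Types (l a u v : V) (S T U : seq V).

(* [v' - v] lies in the span of [S], expressed as the double orthogonal. *)
Lemma project_perp S : exists2 C : R, 0 <= C & forall v t, 0 <= t ->
  (forall l, l \in S -> `|dot l v| <= t) -> exists v',
  [/\ `|v' - v| <= C * t, forall l, l \in S -> dot l v' = 0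
    & forall u, (forall l, l \in S -> dot l u = 0) -> dot u (v' - v) = 0].
Proof.
elim: S => [|a S [C C0 IHS]].
  exists 0 => // v t _ _; exists v; split=> // [|u _]; last by rewrite subrr dot0r.
  by rewrite subrr normr0 mul0r.
(* Gram-Schmidt: [a'] is the component of [a] orthogonal to the span of [S]. The sum only serves as
   some valid bound [t]. *)
have [|l lS|a' [_ a'S a'a]] := IHS a (\sum_(l <- S) `|dot l a|).
- exact: sumr_ge0.
- by rewrite (big_rem _ lS)/= lerDl sumr_ge0.
have aa' : dot a a' = dot a' a'.
  by apply/eqP; rewrite -subr_eq0 -dotBl -opprB dotNl oppr_eq0 dotC a'a.
have [a'0|a'0] := eqVneq a' 0.
  exists C => // v t t0 vt; have [//|l lS|v' [v'v v'S v'u]] := IHS v t.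
    by apply: vt; rewrite inE lS orbT.
  exists v'; split=> // [l|u uS]; last first.
    by apply: v'u => l lS; apply: uS; rewrite inE lS orbT.
  rewrite inE => /predU1P[->|/v'S//].
  by have := a'a v' v'S; rewrite a'0 sub0r dotNr dotC => /eqP; rewrite oppr_eq0 => /eqP.
pose k := dot a' a'; have k0 : 0 < k by exact: dot_gt0.
exists (C + (1 + d%:R * `|a| * C) / k * `|a'|).
  by rewrite addr_ge0// mulr_ge0// divr_ge0 ?(ltW k0)// addr_ge0// !mulr_ge0.
move=> v t t0 vt; have [//|l lS|v1 [v1v v1S v1u]] := IHS v t.
  by apply: vt; rewrite inE lS orbT.
have av1 : `|dot a v1| <= (1 + d%:R * `|a| * C) * t.
  have -> : v1 = v + (v1 - v) by rewrite addrC subrK.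
  rewrite dotDr mulrDl mul1r; apply: le_trans (ler_normD _ _) _.
  rewrite lerD// ?vt ?mem_head//; apply: le_trans (dot_le_norm _ _) _.
  by rewrite -[leRHS]mulrA ler_wpM2l// mulr_ge0.
exists (v1 - (dot a v1 / k) *: a'); split.
- rewrite addrAC; apply: le_trans (ler_normB _ _) _.
  rewrite mulrDl lerD// normrZ [leRHS]mulrAC ler_wpM2r//.
  by rewrite normrM normfV (gtr0_norm k0) [leRHS]mulrAC ler_wpM2r ?invr_ge0 ?(ltW k0).
- move=> l; rewrite inE => /predU1P[->|lS].
    by rewrite dotBr dotZr aa' divfK ?subrr// gt_eqF.
  by rewrite dotBr dotZr v1S// a'S// mulr0 subrr.
- move=> u uS; have uS' l : l \in S -> dot l u = 0.
    by move=> lS; apply: uS; rewrite inE lS orbT.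
  rewrite addrAC dotBr v1u// dotZr -[a'](subrK a) dotDr a'a// (dotC u a).
  by rewrite uS ?mem_head// addr0 mulr0 subrr.
Qed.


(* [S] collects the functionals already known to be small at [v]: they are made to
   vanish. The others are either bounded away from 0, hence keep their sign when [v]
   moves slightly, or small, and then join [S]. *)
Let localizes S T (e h : R) := forall v,
  (forall l, l \in S -> `|dot l v| < h) -> exists v',
  [/\ `|v' - v| <= e,
      forall u, (forall l, l \in T -> dot l u = 0) -> dot u (v' - v) = 0
    & forall l, l \in T -> - h < dot l v -> 0 <= dot l v'].

Let localizes_le S T (e h h' : R) : 0 < h' -> h' <= h ->
  localizes S T e h -> localizes S T e h'.
Proof.
move=> h'0 h'h hP v vl; have [l lS|v' [v'e v'u v'l]] := hP v.
  exact: lt_le_trans (vl l lS) h'h.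
exists v'; split=> // l lT vl'; apply: v'l => //.
by apply: le_lt_trans vl'; rewrite lerN2.
Qed.

(** Either some functional of [U] is below [h1] at [v] and joins [S], or all have size at least [h1]
    and projecting orthogonally to [S] moves [v] too little to make a positive one negative. *)
Let localizes_step S U T (e : R) : 0 < e -> S ++ U =i T ->
  (forall l, l \in U -> exists2 h, 0 < h & localizes (l :: S) T e h) ->
  exists2 h, 0 < h & localizes S T e h.
Proof.
move=> e0 SUT /uniform_witness[|h1 h10 h1P].
  by move=> l h h' h'0 h'h; exact: localizes_le.
have [C C0 CP] := project_perp S.
pose B := 1 + \sum_(l <- U) d%:R * `|l|.
have B0 : 0 < B by rewrite ltr_wpDr// sumr_ge0// => l _; rewrite mulr_ge0.
have C1 : 0 < C + 1 by rewrite ltr_wpDl.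
(* The three bounds make [h] admissible in [h1P], keep the displacement [C * h] within [e], and keep
   the change of each functional of [U] within [h1]. *)
pose h := Num.min h1 (Num.min (e / (C + 1)) (h1 / ((C + 1) * B))).
have h0 : 0 < h by rewrite !lt_min h10 !divr_gt0// mulr_gt0.
have hh1 : h <= h1 by rewrite ge_min lexx.
have Che : C * h <= e.
  have : (C + 1) * h <= e by rewrite mulrC -ler_pdivlMr// !ge_min lexx !orbT.
  by apply: le_trans; rewrite ler_wpM2r ?(ltW h0)// lerDl.
have BCh : B * (C * h) <= h1.
  have : (C + 1) * B * h <= h1.
    by rewrite mulrC -ler_pdivlMr ?mulr_gt0// !ge_min lexx !orbT.
  apply: le_trans; rewrite mulrA [B * C]mulrC ler_wpM2r ?(ltW h0)//.
  by rewrite ler_wpM2r ?(ltW B0)// lerDl.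
exists h => // v vS.
have [[l lU lv]|nU] := pselect (exists2 l, l \in U & `|dot l v| < h1).
  have [l'|v' [v'e v'u v'T]] := h1P l lU v.
    by rewrite inE => /predU1P[->//|l'S]; apply: lt_le_trans hh1; exact: vS.
  exists v'; split=> // l' l'T vl'; apply: v'T => //.
  by apply: le_lt_trans vl'; rewrite lerN2.
have [|l lS|v' [v'v v'S v'u]] := CP v h.
- exact: ltW.
- by apply/ltW/vS.
exists v'; split=> [|u uT|l].
- exact: le_trans v'v Che.
- by apply: v'u => l lS; apply: uT; rewrite -SUT mem_cat lS.
rewrite -SUT mem_cat => /orP[/v'S->//|lU] hlv.
have lvh1 : h1 <= `|dot l v| by rewrite leNgt; apply/negP => ?; apply: nU; exists l.
have lv : h1 <= dot l v.
  move: lvh1; rewrite lter_normr => /orP[//|lvh1].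
  by move: (lt_le_trans hlv (lexx _)) hh1; clearbody h; lra.
have lv'v : `|dot l (v' - v)| <= h1.
  apply: le_trans (dot_le_norm _ _) _; apply: le_trans BCh.
  apply: ler_pM => //.
  by rewrite /B (big_rem _ lU)/= addrCA lerDl addr_ge0// sumr_ge0// => a _; rewrite mulr_ge0.
have := lv'v; rewrite ler_norml dotBr => /andP[+ _]; lra.
Qed.

(** As [h] does not depend on [v], a functional positive somewhere on a thin enough set through [v]
    exceeds [- h] at [v], hence is nonnegative at [v']: one point serves the whole set. The
    induction is on the number of functionals outside [S]. *)
Lemma localize T (e : R) : 0 < e -> exists2 h, 0 < h & forall v, exists v',
  [/\ `|v' - v| <= e,
      forall u, (forall l, l \in T -> dot l u = 0) -> dot u (v' - v) = 0
    & forall l, l \in T -> - h < dot l v -> 0 <= dot l v'].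
Proof.
move=> e0; suff [h h0 hP] : exists2 h, 0 < h & localizes [::] T e h.
  by exists h => // v; exact: hP.
suff rec n U S : size U = n -> S ++ U =i T ->
    exists2 h, 0 < h & localizes S T e h by exact: (rec (size T) T).
elim: n U S => [|n IHn] U S Un SUT.
  by apply: (localizes_step e0 SUT) => l; move/size0nil : Un => ->.
apply: (localizes_step e0 SUT) => l lU; apply: (IHn (rem l U)).
  by rewrite size_rem// Un.
move=> l'; rewrite -SUT; have /perm_mem Ul := perm_to_rem lU.
by rewrite !mem_cat Ul !inE orbCA orbA.
Qed.

(** [T] has finitely many sublists, so one [h] is small enough for all selections [p]; later [p]
    selects the normals vanishing on a flag. *)
Lemma localize_filter T (e : R) : 0 < e -> exists2 h, 0 < h &
  forall (p : pred V) v, exists v', [/\ `|v' - v| <= e,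
      forall u, (forall l, l \in T -> p l -> dot l u = 0) -> dot u (v' - v) = 0
    & forall l, l \in T -> p l -> - h < dot l v -> 0 <= dot l v'].
Proof.
move=> e0; pose masks := enum {: (size T).-tuple bool}.
have [|m _|h h0 hP] := @uniform_witness R _ masks
  (fun m h => localizes [::] (mask m T) e h).
- by move=> m h h' h'0 h'h; exact: localizes_le.
- have [h h0 hP] := localize (mask m T) e0.
  by exists h => // v _; exact: hP.
exists h => // p v.
have /(_ (map_tuple p (in_tuple T)) _ v) := hP.
case=> [|//|v']; first by rewrite mem_enum.
rewrite -filter_mask => -[v'e v'u v'T]; exists v'; split=> // [u uP|l lT pl].
  by apply: v'u => l; rewrite mem_filter => /andP[pl lT]; exact: uP.
by apply: v'T; rewrite mem_filter pl.
Qed.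

End Localization.

(** * Germs along flags *)

Section Lex.
Context {R : realType}.
Implicit Types s : seq R.

Fixpoint lexpos s : bool :=
  if s is x :: s' then (0 < x) || ((x == 0) && lexpos s') else false.

Lemma lexpos_cat s s' :
  lexpos (s ++ s') = lexpos s || (all (fun x => x == 0) s && lexpos s').
Proof.
elim: s => //= x s ->; rewrite andb_orr orbA; congr (_ || _).
by rewrite andbA.
Qed.

Context {d : nat}.
Local Notation V := 'cV[R]_d.
Implicit Types (x u v : V) (vs : seq V) (l : V * R) (F : seq (V * R)).

Definition ev l x := dot l.1 x + l.2.

(* [ev l] is positive at [x + t v1 + t^2 v2 + ...] for all small [t > 0]. *)
Definition germ_pos l x vs := lexpos (ev l x :: map (dot l.1) vs).

Lemma ev_shift l x v : ev l (x + v) = ev l x + dot l.1 v.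
Proof. by rewrite /ev dotDr addrAC. Qed.

Lemma germ_nudge F x v :
  (forall l, l \in F -> 0 < ev l x \/ ev l x = 0 /\ 0 < dot l.1 v) ->
  exists2 t, 0 < t & forall l, l \in F -> 0 < ev l (x + t *: v).
Proof.
move=> Fx; have [l e e' _ e'e eP r r0 re'|l lF|e e0 eP] := @uniform_witness R _ F
  (fun l e => forall r, 0 < r -> r <= e -> 0 < ev l x + r * dot l.1 v).
- by apply: eP => //; exact: le_trans e'e.
- have [lx|[-> lv]] := Fx l lF; last by exists 1 => // r r0 _; rewrite add0r mulr_gt0.
  have D0 : 0 < `|dot l.1 v| + 1 by rewrite ltr_wpDl.
  exists (ev l x / (`|dot l.1 v| + 1)) => [|r r0]; first exact: divr_gt0.
  rewrite ler_pdivlMr// mulrDr mulr1 => rl.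
  have : - (r * `|dot l.1 v|) <= r * dot l.1 v.
    by rewrite -mulrN ler_wpM2l ?(ltW r0)// lerNnormlW.
  lra.
by exists e => // l lF; rewrite ev_shift dotZr; exact: eP.
Qed.

(* The point [x + t1 v1 + t1 t2 v2 + ...] with each [t_i > 0] small enough. *)
Lemma germ_pos_realize F x vs : (forall l, l \in F -> germ_pos l x vs) ->
  exists y, forall l, l \in F -> 0 < ev l y.
Proof.
elim: vs x F => [|v vs IHvs] x F Fpos.
  by exists x => l /Fpos; rewrite /germ_pos /= andbF orbF.
(* Only functionals vanishing at [x] are undecided there. The induction hypothesis, with [v] as base
   point, finds a direction [y] along which all of them increase. *)
pose F0 := [seq (l.1, 0 : R) | l <- F & ev l x == 0].
have [_ /mapP[l + ->]|y yP] := IHvs v F0.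
  rewrite mem_filter => /andP[/eqP l0 /Fpos].
  by rewrite /germ_pos /ev /= -/(ev l x) l0 ltxx eqxx addr0.
have [l lF|t _ tP] := @germ_nudge F x y; last by exists (x + t *: y).
have := Fpos l lF; rewrite /germ_pos/= => /orP[lx|/andP[/eqP l0 _]]; [by left|right].
split=> //; have := yP (l.1, 0); rewrite /ev /= addr0; apply.
by apply/mapP; exists l; rewrite ?mem_filter ?l0 ?eqxx.
Qed.

(** The classes are the cells of a cubic grid of mesh [e]; they cut a bounded set into finitely many
    thin pieces. *)
Lemma box_classes (M e : R) : 0 < e -> exists (K : finType) (cls : V -> K),
  forall u v, `|u| <= M -> `|v| <= M -> cls u = cls v -> `|u - v| < e.
Proof.
move=> e0; pose N := Num.truncn ((M + M) / e).
pose K : finType := {ffun 'I_d -> 'I_N.+1}.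
pose cls (u : V) : K := [ffun i => inord (Num.truncn ((u i 0 + M) / e))].
exists K, cls => u v uM vM uv; apply: norm_lt_entry => // i.
have clsE (w : V) : `|w| <= M -> 0 <= (w i 0 + M) / e /\
    cls w i = Num.truncn ((w i 0 + M) / e) :> nat.
  move=> wM; have : `|w i 0| <= M by apply: le_trans wM; exact: entry_le_norm.
  rewrite ler_norml => /andP[Mw wM'].
  have wi0 : 0 <= (w i 0 + M) / e by apply: divr_ge0; [lra|exact: ltW].
  split=> //; rewrite ffunE inordK// ltnS; apply: le_truncn.
  by rewrite ler_wpM2r ?invr_ge0 ?(ltW e0)// lerD2r.
have [u0 uE] := clsE u uM; have [v0 vE] := clsE v vM.
have := truncn_itv u0; have := truncn_itv v0; rewrite -uE -vE uv.
move=> /andP[v1 v2] /andP[u1 u2]; rewrite !mxE.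
have : `|(u i 0 + M) / e - (v i 0 + M) / e| < 1.
  by rewrite ltr_norml; move: u2 v2; rewrite -natr1 => u2 v2; apply/andP; split; lra.
rewrite -mulrBl normrM normfV (gtr0_norm e0) ltr_pdivrMr// mul1r.
by congr (`|_| < _); ring.
Qed.

End Lex.

(** * Itineraries of piecewise similarities *)

Section Similarities.
Context {R : realType} {d : nat} {I : finType}.
Local Notation V := 'cV[R]_d.
Variables (F : I -> seq (V * R)) (c : I -> R) (Q : I -> 'M[R]_d) (b : I -> V).
Hypothesis c_gt0 : forall i, 0 < c i.
Hypothesis c_le1 : forall i, c i <= 1.
Hypothesis Q_orth : forall i, orthogonal_mx (Q i).
Hypothesis F_disjoint : forall i j y, (forall l, l \in F i -> 0 < ev l y) ->
  (forall l, l \in F j -> 0 < ev l y) -> i = j.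
Implicit Types (x u v a : V) (vs us : seq V) (w p : seq I) (l : V * R).

Definition simil i x : V := c i *: (Q i *m x) + b i.

(* The scaling factors [c i > 0] are dropped on directions: they do not affect signs,
   and orthonormal flags stay orthonormal. *)
Fixpoint germ_itinerary x vs w : bool :=
  if w is i :: w' then all (fun l => germ_pos l x vs) (F i) &&
    germ_itinerary (simil i x) (map (mulmx (Q i)) vs) w'
  else true.

Lemma germ_itinerary_prefix x vs p w :
  germ_itinerary x vs (p ++ w) -> germ_itinerary x vs p.
Proof. by elim: p x vs => //= i p IHp x vs /andP[-> /IHp]. Qed.

(** Two different letters at the same step would put one germ into two pieces; a point realizing the
    germ contradicts [F_disjoint]. *)
Lemma germ_itinerary_unique x vs w w' : size w = size w' ->
  germ_itinerary x vs w -> germ_itinerary x vs w' -> w = w'.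
Proof.
elim: w w' x vs => [|i w IHw] [|j w']//= x vs [ww'] /andP[/allP Fi iw] /andP[/allP Fj jw'].
have ij : i = j.
  have [|y yP] := @germ_pos_realize _ _ (F i ++ F j) x vs.
    by move=> l; rewrite mem_cat => /orP[/Fi|/Fj].
  by apply: (F_disjoint (y := y)) => l lF; apply: yP; rewrite mem_cat lF ?orbT.
by subst j; congr (_ :: _); exact: IHw jw'.
Qed.

(* Facet normals pulled back along words of length less than [m]. *)
Fixpoint normals m : seq V :=
  if m is m'.+1 then flatten [seq map fst (F i) | i <- enum I]
    ++ flatten [seq map (mulmx (Q i)^T) (normals m') | i <- enum I]
  else [::].

Lemma mem_normals i l m : l \in F i -> l.1 \in normals m.+1.
Proof.
move=> lF; rewrite mem_cat; apply/orP; left; apply/flatten_mapP.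
by exists i; rewrite ?mem_enum//; exact: map_f.
Qed.

Lemma normals_pull i a m : a \in normals m -> (Q i)^T *m a \in normals m.+1.
Proof.
move=> am; rewrite mem_cat; apply/orP; right; apply/flatten_mapP.
by exists i; rewrite ?mem_enum//; exact: map_f.
Qed.

(** The directions [us] are consulted only by facets whose normal vanishes on all of [vs], and these
    normals pull back along [w] to members of [normals (size w)]. *)
Lemma germ_itinerary_replace x vs us us' w :
  (forall a, a \in normals (size w) -> all (fun v => dot a v == 0) vs ->
    lexpos (map (dot a) us) -> lexpos (map (dot a) us')) ->
  germ_itinerary x (vs ++ us) w -> germ_itinerary x (vs ++ us') w.
Proof.
elim: w x vs us us' => //= i w IHw x vs us us' usus' /andP[/allP Fi iw].
apply/andP; split.
  apply/allP => l lF; have := Fi l lF; rewrite /germ_pos/= => /orP[->//|/andP[-> /=]].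
  rewrite map_cat lexpos_cat => /orP[vsp|/andP[vs0 usp]]; apply/orP; right.
    by rewrite map_cat lexpos_cat vsp.
  rewrite map_cat lexpos_cat vs0 usus' ?orbT//; first exact: mem_normals lF.
  by rewrite all_map in vs0.
rewrite !map_cat in iw *; apply: IHw iw => a aw; rewrite all_map => vs0.
rewrite -!map_comp; move: (usus' _ (normals_pull i aw)).
by rewrite !(@eq_map _ _ _ (dot a \o mulmx (Q i)))//;
  [apply; apply: sub_all vs0 => v /=; rewrite dot_mulmx|move=> v /=; rewrite dot_mulmx..].
Qed.

(** The component of [u] in the span of [vs] is invisible to normals vanishing on [vs], so [u] can
    be projected. A zero projection decides nothing; a nonzero one is rescaled. *)
Lemma germ_itinerary_normalize x vs u w : germ_itinerary x (rcons vs u) w ->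
  germ_itinerary x vs w \/ exists u', [/\ dot u' u' = 1,
    all (fun v => dot v u' == 0) vs & germ_itinerary x (rcons vs u') w].
Proof.
rewrite -cats1 => uw; have [C _ CP] := project_perp vs.
have [|v vvs|u' [_ u'vs u'u]] := CP u (\sum_(v <- vs) `|dot v u|).
- exact: sumr_ge0.
- by rewrite (big_rem _ vvs)/= lerDl sumr_ge0.
have du a : all (fun v => dot a v == 0) vs -> dot a u = dot a u'.
  move=> /allP avs; apply/eqP; rewrite eq_sym -subr_eq0 -dotBr u'u// => v vvs.
  by rewrite dotC; apply/eqP/avs.
have [u'0|u'0] := eqVneq u' 0.
  left; rewrite -[vs]cats0; apply: germ_itinerary_replace uw => a _ /du /= ->.
  by rewrite u'0 dot0r ltxx andbF.
have uu0 := dot_gt0 u'0; pose r := (Num.sqrt (dot u' u'))^-1.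
have r0 : 0 < r by rewrite invr_gt0 sqrtr_gt0.
right; exists (r *: u'); split.
- by rewrite dotZl dotZr mulrA -expr2 exprVn sqr_sqrtr ?mulVf ?gt_eqF ?ltW.
- by apply/allP => v vvs; rewrite dotZr u'vs// mulr0.
rewrite -cats1; apply: germ_itinerary_replace uw => a _ /du /= ->.
by rewrite dotZr !andbF !orbF pmulr_rgt0.
Qed.

(* Growth rate at most [ln 2 / q] for every [q], in integer arithmetic. *)
Definition flag_bound j := forall q : nat, exists m e, [/\ (0 < m)%N,
  (e ^ q <= 2 ^ m)%N & forall x vs, size vs = j -> orthonormal vs ->
    (word_count m (fun w => exists u, germ_itinerary x (rcons vs u) w) <= e)%N].

(** * Descent on the length of the flag *)

Let thin (D : R) (B : set V) := forall u u', B u -> B u' -> dot (u - u') (u - u') < D ^+ 2.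

(** The state for [word_count_bootstrap]: a base point, a flag, and a thin set of candidates for the
    next direction. *)
Let flag_state j (D : R) (s : V * seq V * set V) :=
  [/\ size s.1.2 = j, orthonormal s.1.2, thin D s.2 &
    forall u, s.2 u -> dot u u = 1 /\ all (fun v => dot v u == 0) s.1.2].

Let flag_alive (s : V * seq V * set V) w :=
  exists2 u, s.2 u & germ_itinerary s.1.1 (rcons s.1.2 u) w.

Let flag_state_next j D s p : flag_state j D s -> exists2 s', flag_state j D s' &
  forall w, flag_alive s (p ++ w) -> flag_alive s' w.
Proof.
elim: p s => [|i p IHp] s ss; first by exists s.
case: s ss => [[x vs] B] [/= sz on th Bu].
have [|s' ss' sP] := IHp (simil i x, map (mulmx (Q i)) vs, [set Q i *m u | u in B]).
  split=> /= [||_ _ [u Bu0 <-] [u' Bu' <-]|_ [u Bu0 <-]].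
  - by rewrite size_map.
  - by rewrite orthonormal_map.
  - by rewrite -mulmxBr dot_orthogonal//; exact: th.
  - rewrite dot_orthogonal//; have [-> vs0] := Bu u Bu0; split=> //.
    by rewrite all_map; apply: sub_all vs0 => v /=; rewrite dot_orthogonal.
exists s' => // w [u /= Bu0 /andP[_ uw]]; apply: sP; exists (Q i *m u).
  by exists u.
by rewrite /= -map_rcons.
Qed.

Let norm_scaled_le (D : R) (A : seq V) a : 0 <= D -> a \in A ->
  d%:R * `|a| * (D / (1 + \sum_(l <- A) d%:R * `|l|)) <= D.
Proof.
move=> D0 aA; have S0 : 0 <= \sum_(l <- A) d%:R * `|l|.
  by rewrite sumr_ge0// => l _; rewrite mulr_ge0.
rewrite mulrCA ler_piMr// ler_pdivrMr ?ltr_wpDr// mul1r.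
rewrite (big_rem _ aA)/= addrCA lerDl addr_ge0// sumr_ge0//.
Qed.

(** All candidates share a direction [v'], which is inserted in the flag before [u]: a relevant
    normal positive at [u] is nonnegative at [v'], and if it vanishes there, [u] still decides. *)
Let flag_state_bound j m e : (forall x vs, size vs = j.+1 -> orthonormal vs ->
    (word_count m (fun w => exists u, germ_itinerary x (rcons vs u) w) <= e)%N) ->
  exists2 D, 0 < D & forall s, flag_state j D s -> (word_count m (flag_alive s) <= e)%N.
Proof.
(* This [r] keeps [v'] nonzero, since the unit vector [v] has sup norm at least [1 / d.+1]. *)
move=> me; pose r : R := 2^-1 / d.+1%:R.
have r0 : 0 < r by rewrite divr_gt0.
have [h h0 hP] := localize_filter (normals m) r0.
exists (h / (1 + \sum_(l <- normals m) d%:R * `|l|)).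
  by rewrite divr_gt0// ltr_wpDr// sumr_ge0// => l _; rewrite mulr_ge0.
move=> [[x vs] B] [/= sz on th Bu].
have [[v Bv]|B0] := pselect (exists v, B v); last first.
  by rewrite word_count_eq0// => w _ [u Bu0 _]; apply: B0; exists u.
have [vv vvs] := Bu v Bv.
have [v' [v'v v'u v'l]] := hP (fun a => all (fun v => dot a v == 0) vs) v.
have v'0 : v' != 0.
  apply/eqP => v'0; have : dot v v < 1 ^+ 2.
    apply: dot_lt_norm => //; move: v'v; rewrite v'0 sub0r normrN => /le_lt_trans; apply.
    by rewrite ltr_pM2r ?invr_gt0//; lra.
  by rewrite vv expr1n ltxx.
(* The selected normals vanish on [vs], so [v' - v] is orthogonal to [vs], as [v] already is. *)
have vsv' : all (fun v => dot v v' == 0) vs.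
  apply/allP => z zvs; have := v'u z; rewrite dotBr => /(_ _)/eqP.
  rewrite (eqP (allP vvs z zvs)) subr0; apply=> a _ /allP/(_ z zvs)/eqP; by [].
have uu0 := dot_gt0 v'0; pose k := (Num.sqrt (dot v' v'))^-1.
have k0 : 0 < k by rewrite invr_gt0 sqrtr_gt0.
apply: leq_trans (me x (rcons vs (k *: v')) _ _); last 2 first.
- by rewrite size_rcons sz.
- rewrite orthonormal_rcons on dotZl dotZr mulrA -expr2 exprVn sqr_sqrtr ?(ltW uu0)//.
  rewrite mulVf ?lt0r_neq0// eqxx; apply: sub_all vsv' => z /eqP zv'.
  by rewrite dotZr zv' mulr0.
apply: word_count_le => w wm [u Bu0 uw]; exists u.
rewrite -[rcons (rcons _ _) _]cats1 -cats1 -catA; rewrite -cats1 in uw.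
apply: germ_itinerary_replace uw => a; rewrite wm => am avs /=.
rewrite !andbF !orbF dotZr => au.
have : 0 <= dot a v'.
  apply: v'l => //.
  have : `|dot a (u - v)| <= h.
    apply: le_trans (dot_le_norm _ _) _; apply: le_trans (norm_scaled_le (ltW h0) am).
    rewrite ler_wpM2l ?mulr_ge0// ltW// norm_lt_dot//; last exact: th.
    by rewrite divr_gt0// ltr_wpDr// sumr_ge0// => l _; rewrite mulr_ge0.
  by rewrite dotBr ler_norml => /andP[]; lra.
by rewrite le_eqVlt pmulr_rgt0// => /orP[/eqP<-|->//]; rewrite mulr0 eqxx au orbT.
Qed.

(** After projection, either [vs] alone determines the word, or the last direction is a unit vector
    in one of finitely many thin classes, where the bound for longer flags can be iterated. *)
Lemma flag_bound_step j : flag_bound j.+1 -> flag_bound j.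
Proof.
(* Asking for [q * 2] leaves half of the exponent to absorb the number of classes. *)
move=> fb q; have [m [e0 [m0 e0m e0P]]] := fb (q * 2)%N.
pose e := maxn e0 1; have e1 : (0 < e)%N by rewrite leq_max orbT.
have em : (e ^ (q * 2) <= 2 ^ m)%N.
  by rewrite /e /maxn; case: ifP => // _; rewrite exp1n expn_gt0.
have [D D0 DP] : exists2 D, 0 < D & forall s, flag_state j D s ->
    (word_count m (flag_alive s) <= e)%N.
  apply: flag_state_bound => x vs sz on; apply: leq_trans (e0P _ _ sz on) _.
  exact: leq_maxl.
have D10 : 0 < D / d.+1%:R by rewrite divr_gt0.
have [K [cls clsP]] := @box_classes R d 1 _ D10.
(* This gives [#|K|.+1 ^ (q * 2) <= 2 ^ k] with [k] positive. In [#|K|.+1] the extra unit accounts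
   for the word determined by [vs] alone. *)
pose k := (#|K|.+1 * (q * 2)).+1.
exists (k * m)%N, (#|K|.+1 * e ^ k)%N; split.
- by rewrite muln_gt0.
- have E1 : ((e ^ k) ^ (q * 2) <= 2 ^ (k * m))%N.
    by rewrite -expnM mulnC expnM [(k * m)%N]mulnC [(2 ^ _)%N]expnM leq_exp2r.
  have E2 : (#|K|.+1 ^ (q * 2) <= 2 ^ (k * m))%N.
    apply: (@leq_trans (2 ^ k)); last by rewrite leq_exp2l// leq_pmulr.
    apply: (@leq_trans ((2 ^ #|K|.+1) ^ (q * 2))).
      have [->//|q0] := posnP (q * 2).
      by rewrite leq_exp2r// ltnW// ltn_expl.
    by rewrite -expnM leq_exp2l.
  rewrite -(@leq_exp2r _ _ 2)// -!expnM expnMn.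
  have -> : (k * m * 2 = k * m + k * m)%N by rewrite muln2 addnn.
  by rewrite expnD leq_mul.
move=> x vs sz on.
pose B kk := [set u | [/\ dot u u = 1, all (fun v => dot v u == 0) vs & cls u = kk]].
apply: (@leq_trans (word_count (k * m) (fun w => germ_itinerary x vs w \/
   exists kk, flag_alive (x, vs, B kk) w))).
  apply: word_count_le => w _ [u /germ_itinerary_normalize[|[u' [u'1 u'vs u'w]]]].
    by left.
  by right; exists (cls u'), u'.
apply: leq_trans (word_count_or _ _ _) _; rewrite mulSn leq_add//.
  apply: leq_trans (word_count_le1 _) _; last by rewrite expn_gt0 e1.
  by move=> w w' wk w'k; apply: germ_itinerary_unique; rewrite wk w'k.
apply: leq_trans (word_count_exists _ _) _; rewrite -sum_nat_const.
apply: leq_sum => kk _.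
apply: (word_count_bootstrap DP) => [s p w [u su]|s p ss _|].
- by move=> /germ_itinerary_prefix; exists u.
- exact: flag_state_next.
split=> //= [u u' [u1 _ uk] [u'1 _ u'k]|u []//].
have norm1 (z : V) : dot z z = 1 -> `|z| <= 1.
  by move=> z1; rewrite -(@expr_le1 _ 2)// -z1 sqr_norm_le_dot.
by apply: dot_lt_norm => //; apply: clsP; rewrite ?norm1 ?uk.
Qed.

(** No orthonormal family has [d.+1] vectors, so the longest case is vacuous and the descent reaches
    the empty flag. *)
Lemma flag_bound0 : flag_bound 0.
Proof.
suff : forall j, (j <= d.+1)%N -> flag_bound (d.+1 - j)%N.
  by move/(_ d.+1 (leqnn _)); rewrite subnn.
elim=> [_|j IHj jd].
  move=> q; exists 1%N, 1%N; rewrite exp1n; split=> // x vs sz on.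
  by have := size_orthonormal on; rewrite sz subn0 ltnn.
by apply: flag_bound_step; rewrite -subSn// subSS; exact: IHj (ltnW jd).
Qed.


(** * From germs at a point to bounded sets of points *)

(** Unlike [normals], these keep scalings and translations, since they are evaluated at base
    points. *)
Fixpoint facets m : seq (V * R) :=
  if m is m'.+1 then flatten [seq F i | i <- enum I]
    ++ flatten [seq [seq (c i *: ((Q i)^T *m l.1), dot l.1 (b i) + l.2) | l <- facets m']
               | i <- enum I]
  else [::].

Lemma ev_simil i l x :
  ev (c i *: ((Q i)^T *m l.1), dot l.1 (b i) + l.2) x = ev l (simil i x).
Proof. by rewrite /ev/= dotZl -dot_mulmx dotDr dotZr addrA. Qed.

(** Where [x] lies on a facet that is positive at [u], the direction from [x] to [u] decides. The
    factor [s] absorbs the scalings [c i], which germ directions ignore. *)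
Lemma germ_itinerary_points x u w (s : R) : 0 < s ->
  (forall l, l \in facets (size w) -> 0 < ev l u -> 0 <= ev l x) ->
  germ_itinerary u [::] w -> germ_itinerary x [:: s *: (u - x)] w.
Proof.
elim: w x u s => //= i w IHw x u s s0 ux /andP[/allP Fi uw].
apply/andP; split.
  apply/allP => l lF; have := Fi l lF; rewrite /germ_pos/= !andbF !orbF => lu.
  have : 0 <= ev l x.
    apply: ux => //; rewrite mem_cat; apply/orP; left; apply/flatten_mapP.
    by exists i; rewrite ?mem_enum.
  rewrite le_eqVlt => /orP[/eqP lx|->//].
  rewrite -lx ltxx eqxx/= dotZr pmulr_rgt0//.
  by move: lu; rewrite -[u in ev l u](subrK x) addrC ev_shift -lx add0r.
have -> : Q i *m (s *: (u - x)) = (s / c i) *: (simil i u - simil i x).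
  rewrite /simil opprD addrACA subrr addr0 -scalerBr -mulmxBr scalerA.
  by rewrite divfK ?gt_eqF// scalemxAr.
apply: IHw uw; first exact: divr_gt0.
move=> l lw; rewrite -!ev_simil; apply: ux; rewrite mem_cat; apply/orP; right.
apply/flatten_mapP; exists i; rewrite ?mem_enum//.
by apply/mapP; exists l.
Qed.

(* Homogenization turns [ev] into [dot] in one more dimension. *)
Lemma affine_localize m : exists2 h, 0 < h &
  forall v, exists x, forall l, l \in facets m -> - h < ev l v -> 0 <= ev l x.
Proof.
pose hl l : 'cV[R]_(d + 1) := col_mx l.1 (const_mx l.2).
have hlE l (z : 'cV[R]_(d + 1)) : dot (hl l) z = dot l.1 (usubmx z) + l.2 * dsubmx z 0 0.
  rewrite /dot big_split_ord big_ord1 /=; congr (_ + _).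
    by apply: eq_bigr => i _; rewrite col_mxEu mxE.
  by rewrite col_mxEd !mxE.
(* Precision one half keeps the last coordinate [s] of [z] positive, so that [z] can be
   dehomogenized. *)
have e0 : 0 < 2^-1 :> R by lra.
have [h h0 hP] := localize (map hl (facets m)) e0.
exists h => // v; have [z [zv _ zl]] := hP (col_mx v (const_mx 1)).
pose s := dsubmx z 0 0; have s0 : 0 < s.
  have := le_trans (entry_le_norm _ (rshift d 0)) zv.
  by rewrite [X in `|X|]mxE [X in _ + X]mxE col_mxEd mxE /s mxE ler_norml => /andP[]; lra.
exists (s^-1 *: usubmx z) => l lm lv.
have : 0 <= dot (hl l) z.
  apply: zl; first exact: map_f.
  by rewrite hlE col_mxKu col_mxKd mxE mulr1.
rewrite hlE -/s => lz; rewrite /ev dotZr -(@pmulr_rge0 _ s)// mulrDr mulrA.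
by rewrite mulfV ?gt_eqF// mul1r [s * _]mulrC.
Qed.

Let thin_alive (B : set V) w := exists2 u, B u & germ_itinerary u [::] w.

Let thin_next D (B : set V) p : thin D B -> exists2 B', thin D B' &
  forall w, thin_alive B (p ++ w) -> thin_alive B' w.
Proof.
elim: p B => [|i p IHp] B tB; first by exists B.
have [|B' tB' BB'] := IHp [set simil i u | u in B].
  move=> _ _ [u Bu <-] [u' Bu' <-].
  rewrite /simil opprD addrACA subrr addr0 -scalerBr -mulmxBr dotZl dotZr mulrA.
  rewrite dot_orthogonal//; apply: le_lt_trans (tB u u' Bu Bu').
  by rewrite -[leRHS]mul1r ler_wpM2r ?dot_ge0// mulr_ile1 ?(ltW (c_gt0 _)).
exists B' => // w [u Bu /= /andP[_ uw]]; apply: BB'; exists (simil i u) => //.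
by exists u.
Qed.

(** A facet positive somewhere on the thin set is nonnegative at a common point [x], so the words of
    the set are words of germs at [x]. *)
Let thin_bound m e : (forall x, (word_count m (fun w =>
    exists u, germ_itinerary x (rcons [::] u) w) <= e)%N) ->
  exists2 D, 0 < D & forall B, thin D B -> (word_count m (thin_alive B) <= e)%N.
Proof.
move=> me; have [h h0 hP] := affine_localize m.
have S0 : 0 < 1 + \sum_(l <- map fst (facets m)) d%:R * `|l|.
  by rewrite ltr_wpDr// sumr_ge0// => l _; rewrite mulr_ge0.
exists (h / (1 + \sum_(l <- map fst (facets m)) d%:R * `|l|)); first exact: divr_gt0.
move=> B tB; have [[v Bv]|B0] := pselect (exists v, B v); last first.
  by rewrite word_count_eq0// => w _ [u Bu0 _]; apply: B0; exists u.
have [x xP] := hP v; apply: leq_trans (me x).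
apply: word_count_le => w wm [u Bu uw]; exists (1 *: (u - x)).
apply: germ_itinerary_points uw => // l; rewrite wm => lm lu; apply: xP => //.
have : `|dot l.1 (u - v)| <= h.
  apply: le_trans (dot_le_norm _ _) _.
  apply: le_trans (norm_scaled_le (ltW h0) (map_f fst lm)).
  by rewrite ler_wpM2l ?mulr_ge0// ltW// norm_lt_dot//; [exact: divr_gt0|exact: tB].
by rewrite dotBr ler_norml => /andP[]; move: lu; rewrite /ev; lra.
Qed.

Lemma itinerary_count (M : R) q : exists m e C : nat, [/\ (0 < m)%N, (0 < e)%N,
  (e ^ q <= 2 ^ m)%N & forall n, (word_count n (fun w => exists2 u : V, (`|u| <= M)%R &
    germ_itinerary u [::] w) <= C * e ^ (n %/ m))%N].
Proof.
have [m [e0 [m0 e0m e0P]]] := flag_bound0 q.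
pose e := maxn e0 1; have e1 : (0 < e)%N by rewrite leq_max orbT.
have em : (e ^ q <= 2 ^ m)%N.
  by rewrite /e /maxn; case: ifP => // _; rewrite exp1n expn_gt0.
have [D D0 DP] : exists2 D, 0 < D & forall B, thin D B ->
    (word_count m (thin_alive B) <= e)%N.
  apply: thin_bound => x; apply: leq_trans (e0P _ [::] _ _) _ => //.
  exact: leq_maxl.
have D10 : 0 < D / d.+1%:R by rewrite divr_gt0.
have [K [cls clsP]] := @box_classes R d M _ D10.
(* [#|K|] counts the thin pieces of the box; the power bounds the words of length [n %% m], its base
   being positive even for empty [I]. *)
exists m, e, (#|K| * #|I|.+1 ^ m)%N; split=> // n.
pose B kk := [set u | `|u| <= M /\ cls u = kk].
rewrite {1}(divn_eq n m) mulnAC.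
apply: (@leq_trans (word_count (n %/ m * m) (fun w => exists kk, thin_alive (B kk) w)
    * #|I|.+1 ^ m)).
  apply: word_count_cat => [p w _ [u uM /germ_itinerary_prefix up]|p _].
    by exists (cls u), u.
  apply: leq_trans (word_count_exp _ _) _.
  apply: (@leq_trans (#|I|.+1 ^ (n %% m))).
    have [->//|n0] := posnP (n %% m)%N.
    by rewrite leq_exp2r.
  by rewrite leq_pexp2l// ltnW// ltn_pmod.
rewrite leq_mul2r; apply/orP; right.
apply: leq_trans (word_count_exists _ _) _; rewrite -sum_nat_const.
apply: leq_sum => kk _.
apply: (word_count_bootstrap DP) => [s p w [u su]|s p ss _|].
- by move=> /germ_itinerary_prefix; exists u.
- exact: thin_next.
by move=> u u' [uM uk] [u'M u'k]; apply: dot_lt_norm => //; apply: clsP; rewrite ?uk.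
Qed.

End Similarities.

(** * Components of a conformal non-expanding map *)

(** For a complex left eigenvector [v], the squared Hermitian norm of [v A] is that of [v] times
    [|z|^2], and also times [c^2] because [A A^T] is [c^2] times the identity. Positive dimension
    provides an eigenvalue. *)
Lemma conformal_ratio_le1 (R : realType) d (A Q : 'M[R]_d) (c : R) : (0 < d)%N ->
  orthogonal_mx Q -> A = c *: Q -> non_expanding_mx A -> `|c| <= 1.
Proof.
move=> d0 QQ AE nexp; have [z zA] := spectral.eigenvalue_closed (complex_mx A) d0.
have z1 := nexp z zA; have /eigenvalueP[v vz v0] := zA.
pose h (u : 'rV[R[i]]_d) : R[i] := (u *m (map_mx Num.conj u)^T) 0 0.
have hE u : h u = \sum_i `|u 0 i| ^+ 2.
  by rewrite /h mxE; apply: eq_bigr => i _; rewrite !mxE normCK.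
have h0 : 0 < h v.
  have hv0 : 0 <= h v by rewrite hE sumr_ge0// => i _; rewrite exprn_ge0.
  rewrite lt_def hv0 andbT; apply: contra v0 => /eqP.
  rewrite hE => /eqP; rewrite psumr_eq0 => [/allP v00|i _]; last by rewrite exprn_ge0.
  apply/eqP/rowP => i; rewrite mxE; have := v00 i (mem_index_enum _).
  by rewrite expf_eq0/= normr_eq0 => /eqP.
have cE : map_mx Num.conj (complex_mx A) = complex_mx A.
  by apply/matrixP => i j; rewrite !mxE; exact: conjc_real.
have AA : complex_mx A *m (complex_mx A)^T = ((c ^+ 2)%:C)%C%:M.
  rewrite /complex_mx matrix.map_trmx -map_mxM AE linearZ/= -scalemxAl -scalemxAr scalerA.
  by rewrite (mulmx1C QQ) scalemx1 map_scalar_mx.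
have : h (v *m complex_mx A) = (c ^+ 2)%:C%C * h v.
  rewrite /h map_mxM cE trmx_mul !mulmxA -[v *m _ *m _]mulmxA AA.
  by rewrite mul_mx_scalar -scalemxAl mxE.
rewrite vz hE; under eq_bigr => i _ do rewrite mxE normrM exprMn.
rewrite -mulr_sumr -hE => /(mulIf (lt0r_neq0 h0)) zc.
have : (c ^+ 2)%:C%C <= 1 by rewrite -zc expr_le1.
by rewrite (_ : 1 = 1%:C%C)// lecR -real_normK ?num_real// expr_le1.
Qed.

Section Polytopes.
Context {R : realType} {d : nat}.
Local Notation V := 'cV[R]_d.
Implicit Types (x u v : V) (l : V * R) (G : seq (V * R)).

Lemma open_polytopeE (Z : set V) : open_polytope Z ->
  exists G, forall x, Z x <-> (forall l, l \in G -> 0 < ev l x).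
Proof.
move=> [_ [m [A [b ->]]]].
exists [seq (- (row i A)^T, b i 0) | i <- enum 'I_m] => x.
have evE i : ev (- (row i A)^T, b i 0) x = b i 0 - (A *m x) i 0.
  rewrite /ev/= dotNl addrC; congr (_ - _); rewrite mxE; apply: eq_bigr => j _.
  by rewrite !mxE.
split=> [Ax _ /mapP[i _ ->]|Gx i]; first by rewrite evE subr_gt0.
by rewrite -subr_gt0 -evE; apply: Gx; apply/mapP; exists i; rewrite ?mem_enum.
Qed.

(** From a point of [Z] one can move along every coordinate axis, and the increments of [f] give the
    columns. This identifies the linear parts supplied separately by conformality and
    non-expansion. *)
Lemma linear_part_unique (f : V -> V) (Z : set V) A A' : open_polytope Z -> Z !=set0 ->
  linear_part f Z A -> linear_part f Z A' -> A = A'.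
Proof.
move=> /open_polytopeE[G ZG] [z Zz] fA fA'.
apply/trmx_inj/row_matrixP => i; rewrite -!tr_col; congr (_^T).
have [l lG|t t0 tG] := @germ_nudge _ _ G z (delta_mx i 0).
  by left; apply: (ZG z).1.
have Zt := (ZG _).2 tG.
have fE B : linear_part f Z B -> f (z + t *: delta_mx i 0) - f z = t *: col i B.
  move=> [k fB]; rewrite !fB// mulmxDr -scalemxAr -colE [_ *m z + _]addrC -[X in X - _]addrA.
  by rewrite addrK.
by apply: (scalerI (lt0r_neq0 t0)); rewrite -(fE A)// -(fE A').
Qed.

Lemma similarity_component (f : V -> V) (Z : set V) : open_polytope Z -> Z !=set0 ->
  (exists2 A, linear_part f Z A & conformal_mx A) ->
  (exists2 A, linear_part f Z A & non_expanding_mx A) ->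
  exists G c Q b, [/\ 0 < c <= 1, orthogonal_mx Q,
    forall x, Z x <-> (forall l, l \in G -> 0 < ev l x)
    & forall x, Z x -> f x = c *: (Q *m x) + b].
Proof.
move=> pZ Z0 [A fA [c [Q [c0 QQ AE]]]] [A' fA' nexp].
have {}nexp : non_expanding_mx A by rewrite (linear_part_unique pZ Z0 fA fA').
have [G ZG] := open_polytopeE pZ; have [b fb] := fA.
(* In dimension zero there is no eigenvalue to bound the ratio, which is set to [1]. *)
have [d0|d0] := posnP d.
  exists G, 1, Q, b; split=> // [|x Zx]; first by rewrite ltr01 lexx.
  by apply/matrixP => i; have := ltn_ord i; rewrite {2}d0.
(* The sign of [c] goes into the orthogonal factor. *)
exists G, `|c|, (Num.sg c *: Q), b; split=> //.
- by rewrite normr_gt0 c0 (conformal_ratio_le1 d0 QQ AE).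
- rewrite /orthogonal_mx [_^T]linearZ/= -scalemxAl -scalemxAr scalerA QQ -expr2 sqr_sg c0.
  by rewrite scale1r.
- by move=> x Zx; rewrite fb// AE -!scalemxAl scalerA mulrC -numEsg.
Qed.

Lemma PAff_similarities (X : set V) ZZ (f : V -> V) : PAff X ZZ f ->
  conformal ZZ f -> non_expanding ZZ f ->
  exists (I : finType) (F : I -> seq (V * R)) c Q b,
  [/\ forall i, 0 < c i <= 1, forall i, orthogonal_mx (Q i),
    forall i j y, (forall l, l \in F i -> 0 < ev l y) ->
      (forall l, l \in F j -> 0 < ev l y) -> i = j,
    forall x, domain ZZ x -> exists i, forall l, l \in F i -> 0 < ev l x
    & forall i x, (forall l, l \in F i -> 0 < ev l x) -> f x = simil c Q b i x].
Proof.
move=> hf hc hn; have [s ZZs] := (finite_seqP _).1 (PAff_finite hf).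
(* Nonempty pieces have unique linear parts; without repetitions, distinct indices give disjoint
   pieces. *)
pose s' := undup [seq Z <- s | `[< Z !=set0 >]].
have s'P (Z : set V) : Z \in s' <-> ZZ Z /\ Z !=set0.
  rewrite mem_undup mem_filter ZZs; split=> [/andP[/asboolP]//|[Zs Z0]].
  by apply/andP; split=> //; exact/asboolP.
have /choice[D DP] : forall i : 'I_(size s'),
    exists D : seq (V * R) * R * 'M[R]_d * V, [/\ 0 < D.1.1.2 <= 1, orthogonal_mx D.1.2,
    forall x, (nth set0 s' i) x <-> (forall l, l \in D.1.1.1 -> 0 < ev l x)
    & forall x, (nth set0 s' i) x -> f x = D.1.1.2 *: (D.1.2 *m x) + D.2].
  move=> i; have [ZZi Zi0] := (s'P _).1 (mem_nth set0 (ltn_ord i)).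
  have [G [c [Q [b GP]]]] := similarity_component (PAff_polytope hf ZZi) Zi0 (hc _ ZZi) (hn _ ZZi).
  by exists (G, c, Q, b).
exists 'I_(size s'), (fun i => (D i).1.1.1), (fun i => (D i).1.1.2),
  (fun i => (D i).1.2), (fun i => (D i).2); split.
- by move=> i; case: (DP i).
- by move=> i; case: (DP i).
- move=> i j y; have [_ _ iP _] := DP i; have [_ _ jP _] := DP j.
  move=> /iP iy /jP jy; apply: val_inj; apply/eqP => /=.
  rewrite -(nth_uniq set0 (ltn_ord i) (ltn_ord j) (undup_uniq _)).
  apply/eqP; apply: contrapT => ij.
  have [ZZi _] := (s'P _).1 (mem_nth set0 (ltn_ord i)).
  have [ZZj _] := (s'P _).1 (mem_nth set0 (ltn_ord j)).
  suff : (nth set0 s' i `&` nth set0 s' j) y by rewrite (PAff_disjoint hf ZZi ZZj ij).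
  by split.
- move=> x [Z ZZZ Zx]; have Zs : Z \in s' by apply/s'P; split=> //; exists x.
  have Zi := Zs; rewrite -index_mem in Zi; exists (Ordinal Zi).
  by have [_ _ iP _] := DP (Ordinal Zi); apply/iP; rewrite /= nth_index.
- by move=> i x; have [_ _ iP fP] := DP i; move=> /iP /fP.
Qed.

End Polytopes.

(** * Entropy *)

Section Entropy.
Context {R : realType} {d : nat}.
Local Notation V := 'cV[R]_d.
Implicit Types (x y u v : V) (X : set V) (ZZ : set (set V)) (f : V -> V) (rho : V -> V -> R).

(** A Lebesgue number argument: each point has a norm ball whose trace on [X] lies in its [rho]-ball
    of radius [e / 2]; half the norm radius works at nearby points, and compactness gives one
    [h]. *)
Lemma uniformly_finer X rho (e : R) : compact X -> defines_topology X rho -> 0 < e ->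
  exists2 h, 0 < h & forall x y, X x -> X y -> `|x - y| < h -> rho x y < e.
Proof.
move=> cX hrho e0; have e20 : 0 < e / 2 by rewrite divr_gt0.
have cov : near_covering X by apply/compact_near_coveringP.
have : \forall h \near 0^'+, X `<=` [set y | X y -> forall z, X z ->
    `|y - z| < h -> rho y z < e].
  apply: cov => x Xx.
  have : within X (nbhs x) [set y | rho x y < e / 2].
    by apply/(metric_nbhs hrho Xx); exists (e / 2).
  move=> /nbhs_ballP[r /= r0 rP].
  have r20 : 0 < r / 2 by rewrite divr_gt0.
  exists (ball x (r / 2), [set h | h < r / 2]) => /=.
    by split; [exact: nbhsx_ballx|exact: nbhs_right_lt].
  move=> [y h] /= [xy hr] Xy z Xz yz.
  have rxy : rho x y < e / 2.
    by apply: rP => //; apply: le_ball xy; rewrite ler_pdivrMr// ler_peMr ?(ltW r0)// ler1n.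
  have rxz : rho x z < e / 2.
    apply: rP => //; rewrite [r]splitr; apply: (ball_triangle xy).
    by rewrite -ball_normE /=; exact: lt_trans yz hr.
  apply: le_lt_trans (metric_triangle hrho Xy Xx Xz) _.
  by rewrite (metric_sym hrho Xy Xx) [e]splitr ltrD.
move=> hX; have [h []] : exists h, 0 < h /\ X `<=` [set y | X y -> forall z, X z ->
    `|y - z| < h -> rho y z < e].
  apply: (@filter_ex _ (0 : R)^'+); apply: filterS2 hX (nbhs_right_gt 0) => h hX h0.
  by split.
by move=> h0 hX'; exists h => // x y Xx Xy; exact: hX'.
Qed.

Section Itineraries.
Context {I : finType}.
Variables (ZZ : set (set V)) (f : V -> V).
Variables (F : I -> seq (V * R)) (c : I -> R) (Q : I -> 'M[R]_d) (b : I -> V).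
Hypothesis c_bound : forall i, 0 < c i <= 1.
Hypothesis Q_orth : forall i, orthogonal_mx (Q i).
Hypothesis F_cover : forall x, domain ZZ x ->
  exists i, forall l, l \in F i -> 0 < ev l x.
Hypothesis fE : forall i x, (forall l, l \in F i -> 0 < ev l x) -> f x = simil c Q b i x.

Let germ_facets i x : all (fun l => germ_pos l x [::]) (F i) ->
  forall l, l \in F i -> 0 < ev l x.
Proof. by move=> /allP Fi l /Fi; rewrite /germ_pos /= andbF orbF. Qed.

Lemma itinerary_exists n x : (forall k, (k < n)%N -> domain ZZ (iter k f x)) ->
  exists2 w, size w = n & germ_itinerary F c Q b x [::] w.
Proof.
elim: n x => [|n IHn] x xn; first by exists [::].
have [i Fi] := F_cover (xn 0%N isT).
have [k kn|w wn fw] := IHn (f x); first by rewrite -iterSr; exact: xn.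
exists (i :: w); first by rewrite /= wn.
rewrite /= -fE// fw andbT; apply/allP => l lF.
by rewrite /germ_pos/= andbF orbF; exact: Fi.
Qed.

Lemma iter_nonexpanding x y w k : germ_itinerary F c Q b x [::] w ->
  germ_itinerary F c Q b y [::] w -> (k < size w)%N ->
  dot (iter k f x - iter k f y) (iter k f x - iter k f y) <= dot (x - y) (x - y).
Proof.
elim: k x y w => [//|k IHk] x y [//|i w] /= /andP[/germ_facets Fx xw].
move=> /andP[/germ_facets Fy yw] kw.
rewrite -!iterS !iterSr; apply: le_trans (IHk _ _ w _ _ kw) _; rewrite ?(fE Fx) ?(fE Fy)//.
rewrite /simil opprD addrACA subrr addr0 -scalerBr -mulmxBr dotZl dotZr mulrA.
have /andP[c0 c1] := c_bound i.
by rewrite dot_orthogonal// -[leRHS]mul1r ler_wpM2r ?dot_ge0// mulr_ile1 ?(ltW c0).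
Qed.

End Itineraries.

(** Points sharing an itinerary and an initial grid cell stay close in norm, hence in [rho], at all
    times below [n]; each nonempty cell contributes one centre. *)
Lemma covers_bound X ZZ f rho (e : R) (q : nat) : PAff X ZZ f -> conformal ZZ f ->
  non_expanding ZZ f -> defines_topology X rho -> 0 < e ->
  exists m E C : nat, [/\ (0 < m)%N, (0 < E)%N, (E ^ q <= 2 ^ m)%N &
    forall n, exists2 s, covers X ZZ f rho n e s & (size s <= C * E ^ (n %/ m))%N].
Proof.
move=> hf hc hn hrho e0.
have [I [F [c [Q [b [c_bound Q_orth F_dis F_cov fE]]]]]] := PAff_similarities hf hc hn.
have [M [_ /(_ (M + 1))XM]] := compact_bounded (PAff_compact hf).
have {}XM x : X x -> `|x| <= M + 1 by apply: XM; rewrite ltrDl.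
have [h h0 hP] := uniformly_finer (PAff_compact hf) hrho e0.
have h10 : 0 < h / d.+1%:R by rewrite divr_gt0.
have [K [cls clsP]] := @box_classes R d (M + 1) _ h10.
have [m [E [C [m0 E0 Eq cnt]]]] := @itinerary_count R d I F c Q b
  (fun i => (andP (c_bound i)).1) (fun i => (andP (c_bound i)).2) Q_orth F_dis (M + 1) q.
exists m, E, (C * #|K|)%N; split=> // n.
have [ws [wsn wsP]] := word_enum n
  (fun w => exists2 u : V, `|u| <= M + 1 & germ_itinerary F c Q b u [::] w).
pose cell (p : seq I * K) := [set x | [/\ iter_domain X ZZ f n x,
  germ_itinerary F c Q b x [::] p.1 & cls x = p.2]].
(* Discarding empty cells ensures that [xget] never returns its default [0] on [ps]. *)
pose ps := [seq p <- [seq (w, k) | w <- ws, k <- enum K] | `[< cell p !=set0 >]].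
have rep p : p \in ps -> cell p (xget 0 (cell p)).
  by rewrite mem_filter => /andP[/asboolP ex _]; exact: xgetPex.
exists [seq xget 0 (cell p) | p <- ps]; last first.
  rewrite size_map size_filter; apply: leq_trans (count_size _ _) _.
  by rewrite size_allpairs -cardE wsn mulnAC leq_mul2r cnt orbT.
split=> [_ /mapP[p /rep[px _ _] ->//]|y [Xy yn]].
have [w wn yw] := itinerary_exists F_cov fE yn.
have yc : cell (w, cls y) y by split.
have wps : (w, cls y) \in ps.
  rewrite mem_filter; apply/andP; split; first by apply/asboolP; exists y.
  apply: allpairs_f; last by rewrite mem_enum.
  by apply/wsP; split=> //; exists y => //; exact: XM.
exists (xget 0 (cell (w, cls y))); first by apply/mapP; exists (w, cls y).
have [[Xx xn] xw /= xy] := rep _ wps.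
apply: bigmax_lt => // k _; have dX z : domain ZZ z -> X z by exact: (PAff_sub hf).
apply: hP; [exact/dX/xn|exact/dX/yn|].
apply: norm_lt_dot => //; apply: le_lt_trans (iter_nonexpanding c_bound Q_orth fE xw yw _) _.
  by rewrite wn.
by apply: dot_lt_norm => //; apply: clsP => //; exact: XM.
Qed.

Lemma entropy_term_ge0 X ZZ f rho n (e : R) :
  (0 <= (n%:R^-1)%:E * er_map (@ln R) (covering_number X ZZ f rho n e))%E.
Proof.
apply: mule_ge0; first by rewrite lee_fin invr_ge0.
have [->|[k ->]] := covering_number_natVinfty X ZZ f rho n e; first exact: leey.
rewrite /= lee_fin; case: k => [|k]; first by rewrite ln0.
by rewrite ln_ge0// ler1n.
Qed.

Lemma entropy_at_eq0 X ZZ f rho (e : R) : PAff X ZZ f -> conformal ZZ f ->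
  non_expanding ZZ f -> defines_topology X rho -> 0 < e ->
  entropy_at X ZZ f rho e = 0%E.
Proof.
move=> hf hc hn hrho e0; apply/eqP; rewrite eq_le; apply/andP; split; last first.
  apply/ereal_infP => _ [A [N _ NA] <-].
  apply: le_trans (entropy_term_ge0 X ZZ f rho N e) _.
  by apply: ereal_sup_ubound; exists N => //; apply: NA => /=.
apply/lee_addgt0Pr => r r0; rewrite add0e.
(* [q] makes [ln 2 / q], hence the growth rate [ln E / m], at most [r / 2]; the other half of [r] is
   for the constant [C]. *)
pose q := (Num.truncn (ln (2 : R) / (r / 2))).+1.
have r20 : 0 < r / 2 by rewrite divr_gt0.
have qr : ln (2 : R) <= q%:R * (r / 2).
  by rewrite -ler_pdivrMr// ltW// truncnS_gt.
have [m [E [C [m0 E0 Eq cov]]]] := covers_bound q hf hc hn hrho e0.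
have m0' : (0 : R) < m%:R by rewrite ltr0n.
have EE0 : 0 <= ln (E%:R : R) by rewrite ln_ge0// ler1n.
have Er : ln (E%:R : R) <= m%:R * (r / 2).
  have q0 : (0 : R) < q%:R by rewrite ltr0n.
  rewrite -(ler_pM2l q0); apply: (@le_trans _ _ (m%:R * ln (2 : R))).
    rewrite !mulr_natl -!lnXn ?ltr0n// -!natrX ler_ln ?posrE ?ltr0n ?expn_gt0 ?E0//.
    by rewrite ler_nat.
  by rewrite mulrCA ler_wpM2l// ltW.
(* From [N] on, [ln C.+1 / n] is at most [r / 2]; the successor in [C.+1] keeps the logarithm's
   argument positive. *)
pose N := (Num.truncn (ln (C.+1%:R : R) / (r / 2))).+1.
apply: (@le_trans _ _ (ereal_sup [set (n%:R^-1)%:E *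
    er_map (@ln R) (covering_number X ZZ f rho n e) | n in [set n | (N <= n)%N]]))%E.
  by apply: ereal_inf_lbound; exists [set n | (N <= n)%N] => //; exists N.
apply/ereal_supP => _ [n /= Nn <-].
have n0 : (0 : R) < n%:R by rewrite ltr0n (leq_trans _ Nn).
have [s cs sn] := cov n.
have : (covering_number X ZZ f rho n e <= (size s)%:R%:E)%E.
  by apply: ereal_inf_lbound; exists s.
have [->|[k ->]] := covering_number_natVinfty X ZZ f rho n e; first by rewrite leye_eq.
rewrite lee_fin ler_nat => ks; rewrite /= -EFinM lee_fin mulrC ler_pdivrMr//.
apply: (@le_trans _ _ (ln ((C.+1 * E ^ (n %/ m))%N%:R))).
  case: k ks => [|k] ks; first by rewrite ln0// ln_ge0// ler1n muln_gt0 expn_gt0 E0.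
  rewrite ler_ln ?posrE ?ltr0n ?muln_gt0 ?expn_gt0 ?E0// ler_nat.
  by apply: leq_trans ks _; apply: leq_trans sn _; rewrite leq_mul2r leqnSn orbT.
rewrite natrM natrX lnM ?posrE ?exprn_gt0 ?ltr0n// lnXn ?ltr0n//.
have Cn : ln (C.+1%:R : R) <= r / 2 * n%:R.
  rewrite mulrC -ler_pdivrMr//; apply: (@le_trans _ _ N%:R); last by rewrite ler_nat.
  by rewrite ltW// truncnS_gt.
have En : ln (E%:R : R) *+ (n %/ m) <= r / 2 * n%:R.
  rewrite -[leLHS]mulr_natl; apply: (@le_trans _ _ ((n %/ m)%N%:R * (m%:R * (r / 2)))).
    by rewrite ler_wpM2l.
  by rewrite mulrA -natrM mulrC ler_wpM2l ?(ltW r20)// ler_nat leq_trunc_div.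
by rewrite [r]splitr mulrDl lerD.
Qed.

End Entropy.

Theorem corollary2 (R : realType) (d : nat) (X : set 'cV[R]_d)
    (ZZ : set (set 'cV[R]_d)) (f : 'cV[R]_d -> 'cV[R]_d)
    (rho : 'cV[R]_d -> 'cV[R]_d -> R)
    (hf : PAff X ZZ f)
    (hconf : conformal ZZ f)
    (hnexp : non_expanding ZZ f)
    (hrho : defines_topology X rho) :
  htop X ZZ f rho = 0%E.
Proof.
apply: lim_near_cst => //; near=> e; apply: entropy_at_eq0 => //.
Unshelve. all: by end_near. Qed.
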